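(* As $x\to\infty$, $$\sum_{r\le x}N_4(0,r)=\frac{5\pi^2}{168\,\zeta(3)}\,x^4+O(x^3\log x).$$
   Context: For $r\in\mathbb{N}=\{1,2,\ldots\}$, $N_4(0,r)$ is the number of solutions $(x,y,z,t)\in(\mathbb{Z}/r\mathbb{Z})^4$ of $x^2+y^2+z^2+t^2\equiv 0\pmod r$. The sum runs over all positive integers $r\le x$. $\zeta$ is the Riemann zeta function. *)

(* Defs.v *)
From mathcomp Require Import all_boot all_order all_algebra.
From mathcomp Require Import all_classical all_reals all_analysis.
Set Implicit Arguments.
Unset Strict Implicit.
Unset Printing Implicit Defensive.
Import Order.TTheory GRing.Theory Num.Theory.
Import numFieldNormedType.Exports.

(* 'I_r, rather than 'Z_r, represents the residues: 'Z_1 has two elements. *)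
Definition N4 (n r : nat) : nat :=
  #|[set v : 'I_r * 'I_r * 'I_r * 'I_r |
      let: (x, y, z, t) := v in
      x ^ 2 + y ^ 2 + z ^ 2 + t ^ 2 == n %[mod r]]|%N.

Local Open Scope ring_scope.

(* The Dirichlet series of the Riemann zeta function at a real argument;
   only meaningful for 1 < s. *)
Definition zeta (R : realType) (s : R) : R :=
  limn (series (fun n : nat => n.+1%:R `^ (- s))).

(* The library makes pinfty_nbhs a filter by a type class instance only,
   whereas the Bachmann-Landau notations look for a canonical filter_on. *)
Canonical pinfty_nbhs_filter_on (R : numFieldType) : filter_on R :=
  FilterType (pinfty_nbhs R) _.

(* Main.v *)
Require Import Defs.
From mathcomp Require Import all_boot all_order all_algebra.
From mathcomp Require Import all_classical all_reals all_analysis.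
From mathcomp Require Import cyclic zify ring lra.
Import Order.TTheory GRing.Theory Num.Theory.
Import numFieldNormedType.Exports.

(** The key is the formula N4(0, r) = r^3 * sum_(d | r) g(d), where g(d) is phi(d) / d^2
    for odd d, 0 for d = 2 mod 4 and -4 phi(d) / d^2 for 4 | d. For odd r the
    congruence a^2 + b^2 = -1 is solvable mod r, so x^2 + y^2 + z^2 + t^2 is equivalent
    to the hyperbolic form uv + ws, whose zeros are counted by
    sum_(u, w) r * gcd(u, w, r) with gcd = sum of phi over the common divisors. The
    powers of 2 follow from N4(0, 4L) = 16 N4(0, L) for even L, and the Chinese
    remainder theorem combines both.

    Writing r = dm, sum_(r <= x) N4(0, r) = sum_d g(d) d^3 sum_(m <= x/d) m^3, where the
    inner sum is (x/d)^4 / 4 + O((x/d)^3). As |g(d)| <= 4/d, the errors add up to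
    O(x^3 log x), and the constant is a quarter of sum_d g(d)/d = 5/7 sum_d phi(d)/d^3
    = 5/7 zeta(2) / zeta(3). The value of zeta(2) comes from Hofbauer's argument: the
    sum of 1/sin^2 t over the angles t = (2k+1) pi / 2^(n+2) with k < 2^n is exactly
    2 * 4^n. *)

Set Implicit Arguments.
Unset Strict Implicit.
Unset Printing Implicit Defensive.

(** * Counting solutions modulo odd numbers and powers of two *)

Lemma N4_sum r : N4 0 r =
  \sum_(x < r) \sum_(y < r) \sum_(z < r) \sum_(t < r)
    (r %| x ^ 2 + y ^ 2 + z ^ 2 + t ^ 2).
Proof.
rewrite /N4 -sum1_card !pair_bigA big_mkcond /=.
by apply: eq_bigr => -[[[x y] z] t] _ /=; rewrite inE mod0n; rewrite -/(dvdn _ _); case: ifP.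
Qed.

(** Reducing each coordinate modulo [m] and modulo [n] is injective by the Chinese remainder
    theorem. Both sides have (mn)^4 elements, so it is bijective, and it matches solutions modulo
    [m * n] with pairs of solutions. *)
Lemma N4_coprime m n : 0 < m -> 0 < n -> coprime m n ->
  N4 0 (m * n) = N4 0 m * N4 0 n.
Proof.
move=> m0 n0 co.
pose p k (k0 : 0 < k) (x : 'I_(m * n)) : 'I_k := Ordinal (ltn_pmod x k0).
pose q k (k0 : 0 < k) (v : 'I_(m * n) * 'I_(m * n) * 'I_(m * n) * 'I_(m * n)) :=
  let: (x, y, z, t) := v in (p k k0 x, p k k0 y, p k k0 z, p k k0 t).
pose f v := (q m m0 v, q n n0 v).
have pinj (x y : 'I_(m * n)) : p m m0 x = p m m0 y -> p n n0 x = p n n0 y -> x = y.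
  move=> /(congr1 val) /= e1 /(congr1 val) /= e2; apply/val_inj => /=.
  rewrite -(modn_small (ltn_ord x)) -(modn_small (ltn_ord y)).
  by apply/eqP; rewrite chinese_remainder // e1 e2 !eqxx.
have finj : injective f.
  move=> [[[x y] z] t] [[[x' y'] z'] t'] [] e1 e2 e3 e4 e5 e6 e7 e8.
  congr (_, _, _, _); apply: pinj; by apply: val_inj.
have fbij : bijective f by apply: inj_card_bij => //; rewrite !card_prod !card_ord; nia.
rewrite /N4 -cardsX -(on_card_preimset (onW_bij _ fbij)).
apply: eq_card => -[[[x y] z] t]; rewrite !inE /=.
rewrite chinese_remainder //; congr (_ && _); congr (_ == _);
rewrite -[LHS]modnDm -[RHS]modnDm; congr ((_ + _) %% _); rewrite ?modnXm //;
rewrite -[LHS]modnDm -[RHS]modnDm; congr ((_ + _) %% _); rewrite ?modnXm //;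
rewrite -[LHS]modnDm -[RHS]modnDm; congr ((_ + _) %% _); rewrite ?modnXm //.
Qed.

(* Since a^2 + b^2 = -1, the substitution (z, t) -> (az + bt, bz - at) turns
   z^2 + t^2 into its opposite, and x^2 - z^2 splits as (x - z)(x + z). *)
Lemma card_sum4sq_hyperbolic (A : finComUnitRingType) (a b : A) :
  (2 : A)%R \is a GRing.unit -> (a ^+ 2 + b ^+ 2 = -1)%R ->
  #|[set v : A * A * A * A | let: (x, y, z, t) := v in
      x ^+ 2 + y ^+ 2 + z ^+ 2 + t ^+ 2 == 0]%R| =
  #|[set v : A * A * A * A | let: (x, y, z, t) := v in x * y + z * t == 0]%R|.
Proof.
move=> u2 ab.
pose f (v : A * A * A * A) := let: (x, y, z, t) := v in
  (x - (a * z + b * t), x + (a * z + b * t),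
   y - (b * z - a * t), y + (b * z - a * t))%R.
pose g (v : A * A * A * A) := let: (x, y, z, t) := v in
  ((x + y) / 2, (z + t) / 2, - (a * ((y - x) / 2) + b * ((t - z) / 2)),
   - (b * ((y - x) / 2) - a * ((t - z) / 2)))%R.
have half (c d : A) : (c = d * 2)%R -> (c / 2 = d)%R by move=> ->; rewrite mulrK.
have fK : cancel f g.
  move=> [[[x y] z] t] /=.
  have -> : (x + (a * z + b * t) - (x - (a * z + b * t)) = (a * z + b * t) * 2)%R by ring.
  have -> : (y + (b * z - a * t) - (y - (b * z - a * t)) = (b * z - a * t) * 2)%R by ring.
  rewrite !mulrK //; congr (_, _, _, _).
  - by apply: half; ring.
  - by apply: half; ring.
  - by transitivity (- (a ^+ 2 + b ^+ 2) * z)%R; [ring | rewrite ab; ring].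
  - by transitivity (- (a ^+ 2 + b ^+ 2) * t)%R; [ring | rewrite ab; ring].
(* An injective self-map of a finite set preserves cardinals of preimages, so the left inverse [g]
   suffices. *)
rewrite -[RHS](card_preimset _ (can_inj fK)).
apply: eq_card => -[[[x y] z] t]; rewrite !inE /=; congr (_ == _).
transitivity (x ^+ 2 + y ^+ 2 - (a ^+ 2 + b ^+ 2) * (z ^+ 2 + t ^+ 2))%R; last by ring.
by rewrite ab; ring.
Qed.

Lemma sum_periodic (f : nat -> nat) m n : m %| n -> (forall x, f (m + x) = f x) ->
  \sum_(x < n) f x = n %/ m * \sum_(x < m) f x.
Proof.
case/dvdnP => q -> fm; have [->|m0] := posnP m; first by rewrite muln0 big_ord0.
rewrite mulnK //; elim: q => [|q IHq]; first by rewrite mul0n big_ord0.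
rewrite mulSn big_split_ord /= mulSn -IHq; congr (_ + _).
by apply: eq_bigr => x _; rewrite fm.
Qed.

(** The map z -> wz + c permutes the residues modulo [r], so it takes the value 0 exactly once. *)
Lemma count_linear_coprime r w c : 0 < r -> coprime w r ->
  \sum_(z < r) (r %| w * z + c) = 1.
Proof.
case: r => // r _ co.
pose f (z : 'I_r.+1) : 'I_r.+1 := inord ((w * z + c) %% r.+1).
have fE z : f z = (w * z + c) %% r.+1 :> nat by rewrite inordK // ltn_mod.
have finj : injective f.
  move=> y z /(congr1 val) /=; rewrite !fE => /eqP.
  rewrite eqn_modDr => e; apply/val_inj => /=.
  wlog le_yz : y z e / y <= z.
    by move=> W; case/orP: (leq_total y z) => h; [exact: W | symmetry; apply: W; rewrite 1?eq_sym].
  move: e; rewrite eq_sym eqn_mod_dvd ?leq_mul2l ?le_yz ?orbT // -mulnBr Gauss_dvdr; last by rewrite coprime_sym.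
  move/dvdn_leq => h; have := ltn_ord z; case: (posnP (z - y)) => [|/h]; lia.
rewrite (eq_bigr (fun z => (f z == ord0 : nat))); last first.
  by move=> z _; rewrite /dvdn -fE.
rewrite -(reindex_inj (F := fun y => (y == ord0 : nat)) (P := xpredT) finj).
by rewrite (bigD1 ord0) //= big1 // => i /negbTE ->.
Qed.

(** Here g = gcd(w, r) must divide [c]. Dividing by g then leaves a coprime congruence modulo r / g,
    whose single solution recurs in each of the g periods below [r]. *)
Lemma count_linear r w c : 0 < r ->
  \sum_(z < r) (r %| w * z + c) = if gcdn w r %| c then gcdn w r else 0.
Proof.
move=> r0; set g := gcdn w r.
have g0 : 0 < g by rewrite gcdn_gt0 r0 orbT.
have gw : g %| w by apply: dvdn_gcdl.
have gr : g %| r by apply: dvdn_gcdr.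
case: ifP => gc; last first.
  rewrite big1 // => z _; apply/eqP; rewrite eqb0; apply/negP => h.
  move/negP: gc; apply.
  by have := dvdn_trans gr h; rewrite dvdn_addr ?dvdn_mulr.
rewrite (@sum_periodic (fun z => nat_of_bool (r %| w * z + c)) (r %/ g)) ?dvdn_div //; last first.
  move=> x; congr nat_of_bool; rewrite mulnDr -addnA dvdn_addr //.
  by rewrite -(divnK gw) -mulnA (mulnC g) divnK // dvdn_mull.
rewrite divnA // mulKn // -[RHS]muln1; congr (_ * _).
rewrite -[RHS](@count_linear_coprime (r %/ g) (w %/ g) (c %/ g)); last 2 first.
- by rewrite divn_gt0 // dvdn_leq.
- by rewrite /coprime -(eqn_pmul2r g0) muln_gcdl !divnK // mul1n.
apply: eq_bigr => z _; congr nat_of_bool.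
rewrite -{1}(divnK gr) -{1}(divnK gw) -{1}(divnK gc).
by rewrite mulnAC -mulnDl dvdn_pmul2r.
Qed.

Lemma count_multiples r d : 0 < r -> d %| r -> \sum_(x < r) (d %| x) = r %/ d.
Proof.
move=> r0 dr; have d0 := dvdn_gt0 r0 dr.
rewrite (@sum_periodic (fun x => nat_of_bool (d %| x)) d) //; last by move=> x; rewrite dvdn_addr.
have := @count_linear d 1 0 d0; rewrite gcd1n dvdn0.
by under eq_bigr do rewrite mul1n addn0; move=> ->; rewrite muln1.
Qed.

(** This is Gauss's identity, the sum of phi over the divisors of n being n, for n = gcd(x, z, r).
    The product of indicators separates [x] from [z], so that the sums over them factor. *)
Lemma sum_totient_gcd r x z : 0 < r ->
  gcdn x (gcdn z r) = \sum_(d < r.+1 | d %| r) totient d * ((d %| x) * (d %| z)).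
Proof.
move=> r0; set G := gcdn x _.
have G0 : 0 < G by rewrite !gcdn_gt0 r0 !orbT.
have Gr : G %| r by rewrite /G gcdnA dvdn_gcdr.
rewrite -{1}[G]sum_totient_dvd (big_ord_widen_cond r.+1 (fun d => d %| G) totient); last by rewrite ltnS dvdn_leq.
rewrite big_mkcond [RHS]big_mkcond; apply: eq_bigr => d _.
rewrite ltnS /G !dvdn_gcd; case: (boolP (d %| r)) => dr; last by rewrite !andbF.
rewrite andbT; case: (boolP (d %| x)) => dx; last by rewrite mul0n muln0.
case: (boolP (d %| z)) => dz; last by rewrite !muln0.
by rewrite !muln1 /= dvdn_leq // /G !dvdn_gcd dx dz.
Qed.

Lemma count_hyperbolic r : 0 < r ->
  \sum_(x < r) \sum_(y < r) \sum_(z < r) \sum_(t < r) (r %| x * y + z * t) =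
  \sum_(d < r.+1 | d %| r) totient d * (r * (r %/ d) ^ 2).
Proof.
move=> r0.
(* For fixed x and z, with g = gcd(z, r), there are g values of t when g divides xy and none
   otherwise. The y with g | xy number (r / g) gcd(x, g). *)
transitivity (\sum_(x < r) \sum_(z < r) r * gcdn x (gcdn z r)).
  apply: eq_bigr => x _; rewrite exchange_big; apply: eq_bigr => z _ /=.
  set g := gcdn z r; have g0 : 0 < g by rewrite gcdn_gt0 r0 orbT.
  have gr : g %| r by apply: dvdn_gcdr.
  transitivity (\sum_(y < r) g * (g %| x * y)).
    apply: eq_bigr => y _; under eq_bigr do rewrite addnC.
    by rewrite count_linear //; case: ifP; rewrite (muln0, muln1).
  rewrite -big_distrr /=.
  rewrite (@sum_periodic (fun y => nat_of_bool (g %| x * y)) g) //; last first.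
    by move=> y; rewrite mulnDr dvdn_addr // dvdn_mull.
  rewrite mulnA (mulnC g) divnK //; congr (_ * _).
  have := @count_linear g x 0 g0; rewrite dvdn0 => <-.
  by apply: eq_bigr => y _; rewrite addn0.
under eq_bigr => x _ do under eq_bigr => z _ do rewrite sum_totient_gcd // big_distrr /=.
under eq_bigr => x _ do rewrite exchange_big.
rewrite exchange_big /=; apply: eq_bigr => d dr.
under eq_bigr => x _ do under eq_bigr => z _ do rewrite mulnA.
under eq_bigr => x _ do rewrite -big_distrr -big_distrr /= count_multiples //.
by rewrite -big_distrr -big_distrl /= count_multiples // mulnn mulnA (mulnC r).
Qed.

Lemma eq0_natr_Zp n m : ((m%:R : 'I_n.+2) == 0)%R = (n.+2 %| m).
Proof. by rewrite Zp_nat -val_eqE. Qed.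

(** Pigeonhole: for arguments from 0 to (p - 1) / 2, the squares x^2 and the values -1 - y^2 form
    two sets of (p + 1) / 2 elements each in a field of [p] elements, so they meet. *)
Lemma sum2sq_prime p : prime p -> odd p -> exists a b, p %| a ^ 2 + b ^ 2 + 1.
Proof.
move=> pp op; have pE := odd_double_half p; rewrite op -addnn in pE.
have p1 := prime_gt1 pp.
have dvdE n : ((n%:R : 'F_p) == 0)%R = (p %| n) by rewrite -(dvdn_pcharf (pchar_Fp pp)).
pose f (x : 'I_p./2.+1) : 'F_p := ((x ^ 2)%:R)%R.
pose g (x : 'I_p./2.+1) : 'F_p := (- 1 - (x ^ 2)%:R)%R.
have finj : injective f.
  move=> x y; rewrite /f => e; apply/val_inj => /=.
  wlog le_yx : x y e / y <= x.
    by move=> W; case/orP: (leq_total y x) => h; [exact: W | symmetry; exact: W].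
  have: p %| x ^ 2 - y ^ 2 by rewrite -dvdE natrB ?leq_sqr // e subrr.
  rewrite subn_sqr Euclid_dvdM // => /orP [] /dvdn_leq h;
  by have := ltn_ord x; have := ltn_ord y; case: (posnP (x - y)); case: (posnP (x + y)); lia.
have ginj : injective g by move=> x y /addrI /oppr_inj; apply: finj.
have : ~~ [disjoint f @: [set: 'I_p./2.+1] & g @: [set: 'I_p./2.+1]].
  apply/negP => dj; have := max_card (f @: [set: 'I_p./2.+1] :|: g @: [set: 'I_p./2.+1]).
  rewrite cardsU disjoint_setI0 // cards0 !card_imset // cardsT card_ord card_Fp //.
  lia.
rewrite fintype.disjoint_subset => /subsetPn [c /imsetP [a _ ->]]; rewrite inE negbK => /imsetP [b _ e].
exists a, b; rewrite -dvdE !natrD -/(f a) e /g; apply/eqP; ring.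
Qed.

(** Hensel lifting with c = a + tq: if a^2 + b^2 + 1 = Nq, the new value is (2at + N)q + t^2 q^2.
    The last term is a multiple of pq since p | q, and t is chosen with 2at + N = 0 mod p, which is
    possible as p does not divide 2a. *)
Lemma sum2sq_hensel p q a b : prime p -> odd p -> 0 < q -> p %| q -> ~~ (p %| a) ->
  q %| a ^ 2 + b ^ 2 + 1 -> exists c, p * q %| c ^ 2 + b ^ 2 + 1.
Proof.
move=> pp op q0 /dvdnP [s qE] pa /dvdnP [N NE].
have co : coprime (2 * a) p.
  by rewrite coprime_sym prime_coprime // Euclid_dvdM // negb_or pa dvdn_prime2 //; case: eqP op => // ->.
have [t pt] : exists t, p %| 2 * a * t + N.
  have := @count_linear_coprime p (2 * a) N (prime_gt0 pp) co.
  case: (boolP [exists t : 'I_p, p %| 2 * a * t + N]) => [/existsP [t pt] _|]; first by exists t.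
  by rewrite negb_exists => /forallP h; rewrite big1 // => i _; rewrite (negbTE (h i)).
exists (a + t * q).
have -> : (a + t * q) ^ 2 + b ^ 2 + 1 = (2 * a * t + N) * q + t ^ 2 * s * (p * q).
  by transitivity (a ^ 2 + b ^ 2 + 1 + 2 * a * t * q + t ^ 2 * q * q); [ring | rewrite NE {3}qE; ring].
by apply: dvdn_add; [rewrite dvdn_pmul2r | apply: dvdn_mull].
Qed.

(** Strong induction, writing r = pq with p the least prime factor. If p does not divide q,
    solutions modulo p and q are glued by the Chinese remainder theorem. Otherwise a solution modulo
    q is lifted in a coordinate prime to p; one exists because p cannot divide both a and b. *)
Lemma sum2sq_odd r : odd r -> exists a b, r %| a ^ 2 + b ^ 2 + 1.
Proof.
elim/ltn_ind: r => r IH or_.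
have [r1|r1] := leqP r 1; first by exists 0, 0; case: r r1 or_ {IH} => [|[]].
have pp := pdiv_prime r1; set p := pdiv r in pp.
have [q rE] : exists q, r = p * q by case/dvdnP: (pdiv_dvd r) => q ->; exists q; rewrite mulnC.
have /andP [op oq] : odd p && odd q by rewrite -oddM -rE.
have q0 : 0 < q by rewrite odd_gt0.
have qr : q < r by rewrite rE ltn_Pmull // prime_gt1.
have [a [b qab]] := IH q qr oq.
rewrite rE; case: (boolP (p %| q)) => pq.
  case: (boolP (p %| a)) => pa; last first.
    by have [c hc] := @sum2sq_hensel p q a b pp op q0 pq pa qab; exists c, b.
  case: (boolP (p %| b)) => pb; last first.
    have [|c hc] := @sum2sq_hensel p q b a pp op q0 pq pb; first by rewrite (addnC (b ^ 2)).
    by exists a, c; rewrite (addnC (a ^ 2)).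
  have := dvdn_trans pq qab; rewrite dvdn_addr ?dvdn1; last by rewrite dvdn_add // dvdn_exp.
  by move/eqP => p1; rewrite p1 in pp.
have co : coprime p q by rewrite prime_coprime.
have [c [d pcd]] := sum2sq_prime pp op.
exists (chinese p q c a), (chinese p q d b).
have cong m x y : m %| x ^ 2 + y ^ 2 + 1 -> forall x' y', x' = x %[mod m] -> y' = y %[mod m] ->
  m %| x' ^ 2 + y' ^ 2 + 1.
  move=> + x' y' ex ey; rewrite /dvdn.
  suff -> : (x ^ 2 + y ^ 2 + 1 = x' ^ 2 + y' ^ 2 + 1 %[mod m]) by [].
  rewrite -(modnDml (x ^ 2 + _)) -(modnDml (x' ^ 2 + _)); congr ((_ + _) %% _).
  by rewrite -(modnDm (x ^ 2)) -(modnDm (x' ^ 2)) -(modnXm _ _ x) -(modnXm _ _ y) -(modnXm _ _ x') -(modnXm _ _ y') ex ey.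
rewrite Gauss_dvd // (cong _ _ _ pcd) ?(cong _ _ _ qab) //;
  by [rewrite chinese_modl | rewrite chinese_modr].
Qed.

Lemma N4_odd r : odd r ->
  N4 0 r = \sum_(d < r.+1 | d %| r) totient d * (r * (r %/ d) ^ 2).
Proof.
move=> or_; rewrite -count_hyperbolic ?odd_gt0 //.
(* The ring structure of residues lives on ['I_n.+2], hence the separate treatment of r = 1. *)
case: r or_ => [|[|n]] // or_.
  by rewrite N4_sum !big_ord1.
have [a [b]] := sum2sq_odd or_; rewrite -eq0_natr_Zp => /eqP ab.
have u2 : (2%:R : 'I_n.+2)%R \is a GRing.unit by rewrite (@unitZpE n.+2) // coprimen2.
have ab' : ((a%:R : 'I_n.+2) ^+ 2 + b%:R ^+ 2 = -1)%R.
  by apply/eqP; rewrite -subr_eq0 opprK -ab !natrD !natrX.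
have E := card_sum4sq_hyperbolic u2 ab'.
transitivity #|[set v : 'I_n.+2 * 'I_n.+2 * 'I_n.+2 * 'I_n.+2 |
   let: (x, y, z, t) := v in x * y + z * t == 0]%R|.
  rewrite -E; apply: eq_card => -[[[x y] z] t]; rewrite !inE mod0n.
  by rewrite -/(dvdn _ _) -eq0_natr_Zp !natrD !natrX !natr_Zp.
rewrite -sum1_card !pair_bigA big_mkcond /=.
apply: eq_bigr => -[[[x y] z] t] _ /=; rewrite inE.
by rewrite -eq0_natr_Zp !natrD !natrM !natr_Zp; case: ifP.
Qed.

(** Odd squares are 1 mod 8 and even ones are 0 mod 4. Modulo 4, one odd term forces all four to be
    odd, but then the sum is 4 mod 8. *)
Lemma sum4sq_mod8 x y z t : 8 %| x ^ 2 + y ^ 2 + z ^ 2 + t ^ 2 -> ~~ odd x.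
Proof.
have sq n : exists j, if odd n then n ^ 2 = 8 * j + 1 else n ^ 2 = 4 * j.
  rewrite -{2 3}(odd_double_half n); case: (odd n); set k := n./2.
    have /dvdnP [j jE] : 2 %| k * k.+1 by rewrite dvdn2 oddM /= andbN.
    by exists j; rewrite -muln2; nia.
  by exists (k ^ 2); rewrite -muln2; nia.
have [a] := sq x; have [b] := sq y; have [c] := sq z; have [d] := sq t.
case: (odd x) => //; case: (odd y); case: (odd z); case: (odd t);
  move=> -> -> -> -> /dvdnP [e]; lia.
Qed.

Lemma sum_ord_even (f : nat -> nat) L : (forall x, f (2 * x + 1) = 0) ->
  (forall x, f (2 * (L + x)) = f (2 * x)) ->
  \sum_(x < 4 * L) f x = 2 * \sum_(x < L) f (2 * x).
Proof.
move=> f1 fL; transitivity (\sum_(x < 2 * L) f (2 * x)).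
  have -> : 4 * L = 2 * (2 * L) by rewrite mulnA.
  elim: (2 * L) => [|m IH]; first by rewrite muln0 !big_ord0.
  by rewrite [RHS]big_ord_recr -IH /= mulnS addnC addn2 !big_ord_recr /= -[(2 * m).+1]addn1 f1 addn0.
case: (posnP L) => [->|L0]; first by rewrite !big_ord0.
by rewrite (@sum_periodic (fun x => f (2 * x)) L) ?dvdn_mull // mulnK.
Qed.

(* All of x, y, z, t are even in a solution modulo 4L, so they can be halved;
   the halves, modulo 2L, are counted twice each by their residues modulo L. *)
Lemma N4_mul4 L : ~~ odd L -> N4 0 (4 * L) = 16 * N4 0 L.
Proof.
rewrite -dvdn2 => L2; rewrite !N4_sum.
have oddE x y z t : (4 * L %| (2 * x + 1) ^ 2 + y ^ 2 + z ^ 2 + t ^ 2) = false.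
  apply: contraTF isT => h; have : ~~ odd (2 * x + 1).
    by apply: (@sum4sq_mod8 _ y z t); apply: dvdn_trans h; rewrite -[8]/(4 * 2) dvdn_pmul2l.
  by rewrite oddD oddM.
have shift a b x : (4 * L %| a + (2 * (L + x)) ^ 2 + b) = (4 * L %| a + (2 * x) ^ 2 + b).
  have -> : a + (2 * (L + x)) ^ 2 + b = (4 * L) * (L + 2 * x) + (a + (2 * x) ^ 2 + b) by ring.
  by rewrite dvdn_addr // dvdn_mulr.
rewrite (@sum_ord_even (fun x => \sum_(y < 4 * L) \sum_(z < 4 * L) \sum_(t < 4 * L)
  (4 * L %| x ^ 2 + y ^ 2 + z ^ 2 + t ^ 2))); last 2 first.
- by move=> x; do 3 ![rewrite big1 // => ? _]; rewrite oddE.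
- move=> x; apply: eq_bigr => y _; apply: eq_bigr => z _; apply: eq_bigr => t _.
  by have := shift 0 (y ^ 2 + z ^ 2 + t ^ 2) x; rewrite !addnA !add0n => ->.
under eq_bigr => x _.
  rewrite (@sum_ord_even (fun y => \sum_(z < 4 * L) \sum_(t < 4 * L)
    (4 * L %| (2 * x) ^ 2 + y ^ 2 + z ^ 2 + t ^ 2))); last 2 first.
  - by move=> y; do 2 ![rewrite big1 // => ? _]; rewrite (addnC ((2 * x) ^ 2)) oddE.
  - move=> y; apply: eq_bigr => z _; apply: eq_bigr => t _.
    by have := shift ((2 * x) ^ 2) (z ^ 2 + t ^ 2) y; rewrite !addnA => ->.
  under eq_bigr => y _.
    rewrite (@sum_ord_even (fun z => \sum_(t < 4 * L)
      (4 * L %| (2 * x) ^ 2 + (2 * y) ^ 2 + z ^ 2 + t ^ 2))); last 2 first.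
    - by move=> z; rewrite big1 // => ? _; rewrite (addnC _ ((2 * z + 1) ^ 2)) addnA oddE.
    - by move=> z; apply: eq_bigr => t _; rewrite shift.
    under eq_bigr => z _.
      rewrite (@sum_ord_even (fun t =>
        (4 * L %| (2 * x) ^ 2 + (2 * y) ^ 2 + (2 * z) ^ 2 + t ^ 2))); last 2 first.
      - by move=> t; rewrite addnC !addnA oddE.
      - by move=> t; have := shift ((2 * x) ^ 2 + (2 * y) ^ 2 + (2 * z) ^ 2) 0 t; rewrite !addn0 => ->.
      under eq_bigr => t _.
        rewrite !expnMn -!mulnDr dvdn_pmul2l //.
      over.
    over.
    rewrite -big_distrr /=.
  over.
  rewrite -big_distrr /= -big_distrr /=.
over.
rewrite -big_distrr /= -big_distrr /= -big_distrr /= !mulnA //.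
Qed.

Lemma N4_pow2 k : N4 0 (2 ^ k.+1) = 2 ^ (2 * k + 3).
Proof.
(* Sums over intervals of naturals can be evaluated by [vm_compute]. Both moduli 2 and 4 are base
   cases, since [N4_mul4] needs an even [L]. *)
have N4_nat r : N4 0 r = \sum_(0 <= x < r) \sum_(0 <= y < r) \sum_(0 <= z < r)
    \sum_(0 <= t < r) (r %| x ^ 2 + y ^ 2 + z ^ 2 + t ^ 2).
  rewrite N4_sum big_mkord; apply: eq_bigr => x _; rewrite big_mkord; apply: eq_bigr => y _.
  by rewrite big_mkord; apply: eq_bigr => z _; rewrite big_mkord.
elim/ltn_ind: k => -[|[|k]] IH.
- by rewrite N4_nat unlock; vm_compute.
- by rewrite N4_nat unlock; vm_compute.
have -> : 2 ^ k.+3 = 4 * 2 ^ k.+1 by rewrite !expnS !mulnA.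
have -> : 2 * k.+2 + 3 = 4 + (2 * k + 3) by lia.
by rewrite N4_mul4 ?oddX // IH // [RHS]expnD.
Qed.

(** * The divisor sum formula for N4 *)

Lemma pow2_odd_factor n : 0 < n -> exists k, exists2 m, odd m & n = 2 ^ k * m.
Proof.
move=> n0; exists (logn 2 n), (n`_2^'); last by rewrite -p_part partnC.
by rewrite -[odd _]negbK -dvdn2 -prime_coprime // (pnat_coprime (pnat_id _)) // part_pnat.
Qed.

Lemma big_divisors (V : nmodType) (f : nat -> V) n : 0 < n ->
  (\sum_(d <- divisors n) f d = \sum_(1 <= d < n.+1 | (d %| n)%N) f d)%R.
Proof.
move=> n0; rewrite -[RHS]big_filter; apply: perm_big; apply: uniq_perm.
- exact: divisors_uniq.
- by rewrite filter_uniq // iota_uniq.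
move=> d; rewrite -dvdn_divisors // mem_filter mem_index_iota.
by case: (boolP (d %| n)) => [dn|//]; rewrite (dvdn_gt0 n0 dn) ltnS dvdn_leq.
Qed.

(** Both sides run over the pairs (d, m) with dm <= n. In the induction, the range of m grows at n +
    1 exactly for the d dividing n + 1, by the term m = (n + 1) / d. *)
Lemma sum_divisors_hyperbola (V : nmodType) (f : nat -> nat -> V) n :
  (\sum_(1 <= r < n.+1) \sum_(d <- divisors r) f d (r %/ d)%N =
   \sum_(1 <= d < n.+1) \sum_(1 <= m < (n %/ d).+1) f d m)%R.
Proof.
elim: n => [|n IHn]; first by rewrite !big_geq.
rewrite big_nat_recr //= {}IHn big_divisors // [X in (_ + X)%R]big_mkcond /=.
rewrite [X in (_ + X)%R]big_nat_recr //= dvdnn divnn [in RHS]big_nat_recr //= divnn /= ?big_nat1.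
rewrite addrA; congr (_ + _)%R; rewrite -big_split /=.
apply: eq_big_nat => d /andP [d0 _]; rewrite divnS //.
by case: (d %| n.+1); rewrite ?addr0 // add1n [in RHS]big_nat_recr.
Qed.

(** The divisors of 2^(k+1) m that do not divide 2^k m are those containing the full power 2^(k+1),
    as [m] is odd. *)
Lemma sum_divisors_pow2S (V : nmodType) (f : nat -> V) k m : odd m ->
  (\sum_(d <- divisors (2 ^ k.+1 * m)%N) f d =
   \sum_(d <- divisors (2 ^ k * m)%N) f d +
   \sum_(d <- divisors m) f (2 ^ k.+1 * d)%N)%R.
Proof.
move=> om; have m0 := odd_gt0 om; have p0 j : 0 < 2 ^ j by rewrite expn_gt0.
rewrite -(big_map (muln (2 ^ k.+1)) xpredT f) -big_cat /=; apply: perm_big; apply: uniq_perm.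
- exact: divisors_uniq.
- rewrite cat_uniq divisors_uniq map_inj_uniq ?divisors_uniq ?andbT /=; last first.
    by move=> x y /eqP; rewrite eqn_pmul2l // => /eqP.
  apply/hasPn => _ /mapP [e _ ->]; rewrite -dvdn_divisors ?muln_gt0 ?p0 //.
  apply/negP => h; have: 2 ^ k * 2 %| 2 ^ k * m.
    by rewrite -expnSr; apply: dvdn_trans h; rewrite dvdn_mulr.
  by rewrite dvdn_pmul2l // dvdn2 om.
move=> d; rewrite mem_cat -!dvdn_divisors ?muln_gt0 ?p0 //.
apply/idP/orP => [dvd|[]]; last 2 first.
- by move=> h; apply: dvdn_trans h _; rewrite dvdn_pmul2r // dvdn_exp2l.
- by case/mapP => e; rewrite -dvdn_divisors // => em ->; rewrite dvdn_pmul2l.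
have d0 : 0 < d by apply: dvdn_gt0 dvd; rewrite muln_gt0 p0.
have [j [e oe dE]] := pow2_odd_factor d0.
have co i x : odd x -> coprime x (2 ^ i) by move=> ox; rewrite coprimeXr // coprimen2.
have em : e %| m.
  by rewrite -(Gauss_dvdr _ (co k.+1 e oe)); apply: dvdn_trans dvd; rewrite dE dvdn_mull.
have : 2 ^ j %| 2 ^ k.+1.
  rewrite -(@Gauss_dvdl _ _ m) 1?coprime_sym ?co //; apply: dvdn_trans dvd; rewrite dE dvdn_mulr //.
rewrite dvdn_Pexp2l // leq_eqVlt => /orP [/eqP jk|jk].
  by right; apply/mapP; exists e; rewrite -?dvdn_divisors // dE jk.
by left; rewrite dE dvdn_mul // dvdn_exp2l.
Qed.

Local Open Scope ring_scope.

(* In terms of the quadratic Gauss sums G(k, d), this is the sum of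
   (G(k, d) / d) ^ 4 over the k mod d coprime to d: G(k, d) ^ 4 is d ^ 2 for odd d,
   0 for d = 2 mod 4 and -4 d ^ 2 for 4 | d. *)
Definition N4_coef (R : numFieldType) (d : nat) : R :=
  (if odd d then 1 else if (4 %| d)%N then - 4 else 0) *
    (totient d)%:R / d%:R ^+ 2.

Lemma natr_N4_odd (R : numFieldType) m : odd m ->
  (N4 0 m)%:R = m%:R ^+ 3 * \sum_(d <- divisors m) N4_coef R d.
Proof.
move=> om; have m0 := odd_gt0 om; rewrite N4_odd // natr_sum big_distrr /=.
rewrite big_divisors // big_add1 /= big_mkcond big_ord_recl /= dvd0n.
rewrite -[(m == 0)%N]negbK -lt0n m0 /= add0r [RHS]big_mkcond [RHS]big_mkord.
apply: eq_bigr => i _; rewrite /bump /= add1n; case: ifP => // im.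
have im0 : (i.+1%:R : R) != 0 by rewrite pnatr_eq0.
have oi : odd i.+1 by apply: dvdn_odd im om.
rewrite /N4_coef oi !natrM natf_div //.
by move: (i.+1%:R : R) im0 => c c0; field.
Qed.

(** Let F be the sum over the divisors of [m]. The divisors 2d contribute 0, and for j >= 2 the
    divisors 2^j d contribute -4 phi(2^j) / 4^j F = -F / 2^(j-1). The geometric sum up to j = k + 1
    leaves F / 2^k. *)
Lemma N4_coef_pow2 (R : numFieldType) k m : odd m ->
  \sum_(d <- divisors (2 ^ k.+1 * m)) N4_coef R d =
  (\sum_(d <- divisors m) N4_coef R d) / 2 ^+ k.
Proof.
move=> om; set F := \sum_(d <- divisors m) _.
elim: k => [|k IHk].
  rewrite sum_divisors_pow2S // !mul1n [X in _ + X]big1_seq ?addr0 ?expr0 ?divr1 // => d.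
  rewrite -dvdn_divisors ?odd_gt0 // => /andP [_ dm].
  have od := dvdn_odd dm om.
  rewrite /N4_coef oddM /= -[4%N]/(2 * 2)%N expn1 dvdn_pmul2l // dvdn2 od /=.
  by rewrite !mul0r.
rewrite sum_divisors_pow2S // IHk.
rewrite (_ : \sum_(d <- divisors m) _ = - F / 2 ^+ k.+1); last first.
  rewrite mulNr -mulrN mulr_suml; apply: eq_big_seq => d.
  rewrite -dvdn_divisors ?odd_gt0 // => dm; have od := dvdn_odd dm om.
  have d0 : (d%:R : R) != 0 by rewrite pnatr_eq0 -lt0n odd_gt0.
  have d4 : (4 %| 2 ^ k.+2 * d)%N by rewrite !expnS !mulnA -mulnA dvdn_mulr.
  rewrite /N4_coef od oddM oddX d4 /=.
  rewrite totient_coprime; last by rewrite coprimeXl // coprime2n.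
  rewrite totient_pfactor // !natrM !natrX !exprS /=.
  have : (2 ^+ k : R) != 0 by rewrite expf_neq0 ?pnatr_eq0.
  move: (d%:R : R) d0 => c c0; move: (2 ^+ k : R) => p p0.
  by field; rewrite c0 p0.
have : (2 ^+ k : R) != 0 by rewrite expf_neq0 ?pnatr_eq0.
by rewrite exprS => p0; field.
Qed.

Lemma natr_N4 (R : numFieldType) r : (0 < r)%N ->
  (N4 0 r)%:R = r%:R ^+ 3 * \sum_(d <- divisors r) N4_coef R d.
Proof.
move=> r0; have [k [m om ->]] := pow2_odd_factor r0.
case: k => [|k]; first by rewrite mul1n natr_N4_odd.
rewrite N4_coef_pow2 // N4_coprime ?expn_gt0 ?(odd_gt0 om) //; last by rewrite coprimeXl // coprime2n.
rewrite N4_pow2 !natrM natr_N4_odd // !natrX exprD mulnC exprM !exprS.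
have : (2 ^+ k : R) != 0 by rewrite expf_neq0 ?pnatr_eq0.
move: (2 ^+ k : R) => p p0; by field.
Qed.

Lemma totient_leq n : (totient n <= n)%N.
Proof.
rewrite totient_count_coprime big_mkord -[leqRHS]card_ord -sum1_card.
by apply: leq_sum => i _; case: coprime.
Qed.

Lemma ler_norm_N4_coef (R : numFieldType) d : `|N4_coef R d| <= 4 / d%:R.
Proof.
case: d => [|d]; first by rewrite /N4_coef mulr0 mul0r normr0 invr0 mulr0.
have d0 : (0 : R) < d.+1%:R by rewrite ltr0n.
rewrite /N4_coef !normrM normfV normrX !normr_nat.
rewrite ler_pdivrMr ?exprn_gt0 // expr2 mulrA divfK ?gt_eqF //.
apply: ler_pM => //; last by rewrite ler_nat totient_leq.
by case: ifP => _; [rewrite normr1 ler1n | case: ifP => _; rewrite ?normrN ?normr0 ?normr_nat].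
Qed.

(** * The value of zeta(2) *)

Lemma sin_le_id (R : realType) (x : R) : 0 <= x -> sin x <= x.
Proof.
rewrite le_eqVlt => /predU1P [<-|x0]; first by rewrite sin0.
have [|c _] := @MVT R sin cos 0 x x0.
  by apply: continuous_subspaceT => y; exact: continuous_sin.
rewrite sin0 !subr0 => ->; rewrite -[leRHS]mul1r ler_wpM2r ?(ltW x0) // cos_le1.
Qed.

Lemma mul_cos_le_sin (R : realType) (x : R) : 0 <= x < pi / 2 -> x * cos x <= sin x.
Proof.
case/andP; rewrite le_eqVlt => /predU1P [<-|x0 xpi]; first by rewrite mul0r sin0.
have [|c /andP [c0 cx]] := @MVT R sin cos 0 x x0.
  by apply: continuous_subspaceT => y; exact: continuous_sin.
have p2 : pi / 2 <= (pi : R) by have := pi_gt0 R; lra.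
rewrite sin0 !subr0 => ->; rewrite mulrC ler_wpM2r ?(ltW x0) //.
rewrite ltW // ltr_cos ?in_itv /=; move: c0 cx; rewrite !bnd_simp => c0 cx; first by [].
all: apply/andP; split; lra.
Qed.

Lemma sin_inv_sq_double (R : realType) (x : R) : sin x != 0 -> cos x != 0 ->
  (sin x ^+ 2)^-1 + (cos x ^+ 2)^-1 = 4 * (sin (x *+ 2) ^+ 2)^-1.
Proof.
move=> s0 c0; have := cos2Dsin2 x; rewrite sin_mulr2n.
move: (sin x) (cos x) s0 c0 => s c s0 c0 e.
have -> : (s ^+ 2)^-1 + (c ^+ 2)^-1 = (c ^+ 2 + s ^+ 2) / (s ^+ 2 * c ^+ 2).
  by field; rewrite s0 c0.
by rewrite e; field; rewrite s0 c0.
Qed.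

Lemma sum_ord_fold (V : nmodType) (f : nat -> V) n :
  \sum_(k < n + n) f k = \sum_(k < n) (f k + f (n + n - k.+1)%N).
Proof.
rewrite big_split_ord big_split /=; congr (_ + _).
rewrite (reindex_inj rev_ord_inj) /=; apply: eq_bigr => k _; congr f.
by have := ltn_ord k; lia.
Qed.

(** Pairing t with pi / 2 - t gives 1 / sin^2 t + 1 / cos^2 t = 4 / sin^2 (2t), and doubling carries
    the first half of the angles of level n + 1 onto those of level n. Hence each level multiplies
    the sum by 4. *)
Lemma sum_sin_inv_sq (R : realType) n :
  \sum_(k < 2 ^ n) (sin (k.*2.+1%:R * pi / 2 ^+ n.+2 : R) ^+ 2)^-1 = 2 * 4 ^+ n.
Proof.
have p0 := pi_gt0 R.
elim: n => [|n IHn].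
  rewrite big_ord1 mul1r expr0 mulr1.
  (* At the only angle pi / 4 of level 0, sine and cosine agree, so the doubling identity reads 2 /
     sin^2 (pi / 4) = 4. *)
  have h := @sin_inv_sq_double R (pi / 4).
  have s0 : 0 < sin (pi / 4 : R) by apply: sin_gt0_pihalf; apply/andP; split; lra.
  have c : sin (pi / 4 : R) = cos (pi / 4).
    rewrite -sinDpihalf; rewrite -[in LHS](opprK (pi / 4)) sinN -sinDpi.
    by congr sin; field.
  have pE : pi / 4 *+ 2 = pi / 2 :> R by field.
  move: h; rewrite -c pE sin_pihalf expr1n invr1 mulr1 => /(_ (lt0r_neq0 s0) (lt0r_neq0 s0)).
  by rewrite (_ : 2 ^+ 2 = 4 :> R); [lra | ring].
pose f k := (sin (k.*2.+1%:R * pi / 2 ^+ n.+3 : R) ^+ 2)^-1.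
(* The k-th angle from the end is the complement of the k-th one. *)
rewrite expnS mul2n -addnn (sum_ord_fold f) /f [4 ^+ n.+1]exprS mulrCA -IHn big_distrr /=.
apply: eq_bigr => k _.
set x := k.*2.+1%:R * pi / 2 ^+ n.+3.
have q0 : (0 : R) < 2 ^+ n by rewrite exprn_gt0.
have kn : (k.*2.+1%:R : R) < 2 ^+ n.+1.
  by rewrite -natrX ltr_nat expnS; have := ltn_ord k; lia.
have -> : (2 ^ n + 2 ^ n - k.+1).*2.+1%:R * pi / 2 ^+ n.+3 = pi / 2 - x.
  have -> : (2 ^ n + 2 ^ n - k.+1).*2.+1 = (2 ^ n.+2 - k.*2.+1)%N.
    by rewrite !expnS; have := ltn_ord k; lia.
  rewrite natrB; last by rewrite !expnS; have := ltn_ord k; lia.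
  by rewrite /x natrX !exprS; move: (2 ^+ n : R) q0 => q q0; field; rewrite gt_eqF.
have -> : k.*2.+1%:R * pi / 2 ^+ n.+2 = x *+ 2.
  by rewrite /x !exprS; move: (2 ^+ n : R) q0 => q q0; field; rewrite gt_eqF.
have x0 : 0 < x by rewrite /x divr_gt0 ?exprn_gt0 // mulr_gt0.
have xp : x < pi / 2.
  rewrite /x ltr_pdivrMr ?exprn_gt0 //.
  have -> : (pi : R) / 2 * 2 ^+ n.+3 = (2 * 2 ^+ n.+1) * pi by rewrite !exprS; field.
  rewrite ltr_pM2r //; have : (0 : R) < 2 ^+ n.+1 by rewrite exprn_gt0. 
  by move: kn; lra.
have -> : sin (pi / 2 - x) = cos x by rewrite addrC sinDpihalf cosN.
rewrite -sin_inv_sq_double // gt_eqF //.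
  by apply: sin_gt0_pihalf; rewrite x0.
by apply: cos_gt0_pihalf; rewrite xp andbT; lra.
Qed.

(* cot^2 t <= 1 / t^2 <= 1 / sin^2 t, summed over the angles of sum_sin_inv_sq. *)
Lemma sum_odd_inv_sq_bounds (R : realType) n :
  (pi : R) ^+ 2 / 8 - (pi : R) ^+ 2 / 16 * 2 ^- n <=
  \sum_(k < 2 ^ n) (k.*2.+1%:R ^+ 2)^-1 <= (pi : R) ^+ 2 / 8.
Proof.
have p0 := pi_gt0 R; pose t k : R := k.*2.+1%:R * pi / 2 ^+ n.+2.
have q0 : (0 : R) < 2 ^+ n by rewrite exprn_gt0.
have tE k : (k.*2.+1%:R ^+ 2)^-1 = ((pi : R) ^+ 2 / 16 / 4 ^+ n) * (t k ^+ 2)^-1 :> R.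
  have -> : (4 : R) ^+ n = 2 ^+ n ^+ 2 by rewrite -exprM mulnC exprM; congr (_ ^+ _); ring.
  have k0 : (k.*2.+1%:R : R) != 0 by rewrite pnatr_eq0.
  rewrite /t !exprS; move: (k.*2.+1%:R : R) k0 => c c0; move: (2 ^+ n : R) q0 => q q0.
  by move: (pi : R) p0 => p p0; field; rewrite c0 !gt_eqF.
have bnd (k : 'I_(2 ^ n)) : (sin (t k) ^+ 2)^-1 - 1 <= (t k ^+ 2)^-1 <= (sin (t k) ^+ 2)^-1.
  have t0 : 0 < t k by rewrite /t divr_gt0 ?exprn_gt0 // mulr_gt0.
  have tp : t k < pi / 2.
    rewrite /t ltr_pdivrMr ?exprn_gt0 //.
    have -> : (pi : R) / 2 * 2 ^+ n.+2 = 2 ^+ n.+1 * pi by rewrite !exprS; field.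
    by rewrite ltr_pM2r // -natrX ltr_nat expnS; have := ltn_ord k; lia.
  have s0 : 0 < sin (t k) by apply: sin_gt0_pihalf; rewrite t0.
  have c0 : 0 < cos (t k) by apply: cos_gt0_pihalf; rewrite tp andbT; lra.
  apply/andP; split; last first.
    by rewrite lef_pV2 ?posrE ?exprn_gt0 // ler_pXn2r ?nnegrE ?(ltW s0) ?(ltW t0) // sin_le_id // ltW.
  have -> : (sin (t k) ^+ 2)^-1 - 1 = (cos (t k) / sin (t k)) ^+ 2.
    rewrite expr_div_n cos2sin2; field; rewrite gt_eqF //.
  rewrite -exprVn ler_pXn2r ?nnegrE ?divr_ge0 ?invr_ge0 ?(ltW s0) ?(ltW t0) ?(ltW c0) //.
  rewrite ler_pdivrMr // mulrC ler_pdivlMr // mulrC.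
  by apply: mul_cos_le_sin; rewrite tp ltW.
have f0 : (0 : R) < 4 ^+ n by rewrite exprn_gt0.
have c0 : 0 <= (pi : R) ^+ 2 / 16 / 4 ^+ n by rewrite !divr_ge0 ?exprn_ge0 // ltW.
under eq_bigr do rewrite tE; rewrite -big_distrr /=.
have S1 : \sum_(k < 2 ^ n) (t k ^+ 2)^-1 <= 2 * 4 ^+ n.
  by rewrite -sum_sin_inv_sq; apply: ler_sum => k _; case/andP: (bnd k).
(* Each of the 2^n terms loses 1 in cot^2 t = 1 / sin^2 t - 1. *)
have S2 : 2 * 4 ^+ n - 2 ^+ n <= \sum_(k < 2 ^ n) (t k ^+ 2)^-1.
  rewrite -sum_sin_inv_sq [X in _ - X](_ : _ = \sum_(k < 2 ^ n) 1); last first.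
    by rewrite sumr_const card_ord natrX.
  by rewrite -sumrB; apply: ler_sum => k _; case/andP: (bnd k).
apply/andP; split.
  apply: le_trans (ler_wpM2l c0 S2); rewrite le_eqVlt; apply/orP; left; apply/eqP.
  have -> : (4 : R) ^+ n = 2 ^+ n ^+ 2 by rewrite -exprM mulnC exprM; congr (_ ^+ _); ring.
  by move: (pi : R) (2 ^+ n : R) q0 => p q q0; field; rewrite gt_eqF.
apply: le_trans (ler_wpM2l c0 S1) _; rewrite le_eqVlt; apply/orP; left; apply/eqP.
by move: (pi : R) (4 ^+ n : R) f0 => p q f0; field; rewrite gt_eqF.
Qed.

Lemma cvg_expnl m : (1 < m)%N -> ((m ^ n)%N @[n --> \oo] --> \oo)%classic.
Proof.
move=> m1 A [N _ NA]; exists N => // n /= Nn; apply: NA => /=.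
exact: leq_trans Nn (ltnW (ltn_expl n m1)).
Qed.

(** Telescoping, from 1 / (n + 1)^2 <= 1 / n - 1 / (n + 1). *)
Lemma sum_inv_sq_tail (R : numFieldType) m n : (0 < m <= n)%N ->
  \sum_(m.+1 <= d < n.+1) (d%:R ^+ 2)^-1 <= m%:R^-1 - n%:R^-1 :> R.
Proof.
case/andP => m0; elim: n => [|n IHn]; first by rewrite leqn0 => /eqP ->; rewrite big_geq // subrr.
rewrite leq_eqVlt ltnS => /predU1P [->|mn]; first by rewrite big_geq // subrr.
rewrite big_nat_recr ?ltnS //=; have := IHn mn.
have n0 : (0 : R) < n%:R by rewrite ltr0n (leq_trans m0).
have : (n.+1%:R ^+ 2)^-1 <= n%:R^-1 - n.+1%:R^-1 :> R.
  rewrite -natr1; move: (n%:R : R) n0 => c c0.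
  have c1 : 0 < c + 1 by rewrite addr_gt0.
  have -> : c^-1 - (c + 1)^-1 = (c * (c + 1))^-1 by field; rewrite !gt_eqF.
  rewrite lef_pV2 ?posrE ?mulr_gt0 ?exprn_gt0 // expr2 ler_pM2r // lerDl //.
move=> h1 h2; apply: le_trans (lerD h2 h1) _.
by rewrite addrA subrK.
Qed.

Definition psum (R : realType) (a : nat -> R) (n : nat) : R := \sum_(1 <= d < n.+1) a d.

Lemma psumS (R : realType) (a : nat -> R) n : psum a n.+1 = psum a n + a n.+1.
Proof. by rewrite /psum big_nat_recr. Qed.

Lemma nondecreasing_psum (R : realType) (a : nat -> R) : (forall n, 0 <= a n) ->
  {homo psum a : m n / (m <= n)%N >-> m <= n}.
Proof.
move=> a0; apply/nondecreasing_seqP => n.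
by rewrite psumS lerDl.
Qed.

Lemma is_cvg_psum (R : realType) (a : nat -> R) B : (forall n, 0 <= a n) ->
  (forall n, psum a n <= B) -> cvgn (psum a).
Proof.
move=> a0 aB; apply: nondecreasing_is_cvgn; first exact: nondecreasing_psum.
by exists B => _ [n _ <-].
Qed.

Lemma psum_inv_sq_le2 (R : realType) n : psum (fun d => (d%:R ^+ 2)^-1) n <= 2 :> R.
Proof.
case: n => [|n]; first by rewrite /psum big_geq.
rewrite /psum big_ltn // expr1n invr1.
have := @sum_inv_sq_tail R 1 n.+1 isT; rewrite invr1 => h.
have : (0 : R) <= n.+1%:R^-1 by rewrite invr_ge0.
move=> n0; apply: (@le_trans _ _ (1 + (1 - n.+1%:R^-1))); last by move: n0; move: (_^-1) => c; lra.
by rewrite lerD2l; exact: h.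
Qed.

Lemma psum_inv_sq_even (R : realType) n :
  psum (fun d => (d%:R ^+ 2)^-1) (2 * n) =
  \sum_(k < n) (k.*2.+1%:R ^+ 2)^-1 + psum (fun d => (d%:R ^+ 2)^-1) n / 4 :> R.
Proof.
elim: n => [|n IHn]; first by rewrite muln0 /psum !big_geq // big_ord0 mul0r addr0.
rewrite mulnS !psumS -/(2 * n)%N {}IHn big_ord_recr /= -mul2n.
have -> : ((2 * n).+2%:R ^+ 2)^-1 = (n.+1%:R ^+ 2)^-1 / 4 :> R.
  have n0 : (n.+1%:R : R) != 0 by rewrite pnatr_eq0.
  have -> : (2 * n).+2 = (2 * n.+1)%N by lia.
  by rewrite natrM; move: (n.+1%:R : R) n0 => c c0; field.
ring.
Qed.

(** Let L be the limit. Along the powers of 2 the odd terms sum to L - L / 4, because the even terms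
    are a quarter of the whole series; this equals pi^2 / 8 by [sum_odd_inv_sq_bounds]. *)
Lemma cvg_psum_inv_sq (R : realType) :
  (psum (fun d => (d%:R ^+ 2)^-1) n @[n --> \oo] --> ((pi : R) ^+ 2 / 6))%classic.
Proof.
set u := psum _; have cu : cvgn u.
  by apply: is_cvg_psum (@psum_inv_sq_le2 R) => n; rewrite invr_ge0 exprn_ge0.
have uL : (u (2 ^ n)%N @[n --> \oo] --> limn u)%classic := cvg_comp _ _ (cvg_expnl (isT : 1 < 2)%N) cu.
have u2L : (u (2 * 2 ^ n)%N @[n --> \oo] --> limn u)%classic.
  apply: (cvg_comp (fun n => 2 * 2 ^ n)%N u) cu.
  by under eq_fun do rewrite -expnS; apply: (cvg_comp S (expn 2)) (cvg_addnl 1) _; exact: cvg_expnl.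
have oL : (\sum_(k < 2 ^ n) (k.*2.+1%:R ^+ 2)^-1 @[n --> \oo] --> limn u - limn u / 4)%classic.
  rewrite (_ : (fun n => _) = (fun n => u (2 * 2 ^ n)%N - u (2 ^ n)%N / 4)); last first.
    by apply/funext => n; rewrite /u psum_inv_sq_even addrK.
  by apply: cvgB => //; apply: cvgMl.
have oP : (\sum_(k < 2 ^ n) (k.*2.+1%:R ^+ 2)^-1 @[n --> \oo] --> ((pi : R) ^+ 2 / 8))%classic.
  apply: (squeeze_cvgr (f := fun n => (pi : R) ^+ 2 / 8 - (pi : R) ^+ 2 / 16 * 2 ^- n) (h := fun=> (pi : R) ^+ 2 / 8)).
  - by apply: nearW => n; exact: sum_odd_inv_sq_bounds.
  - rewrite -[X in (_ --> X)%classic]subr0 -[X in (_ --> _ - X)%classic](mulr0 ((pi : R) ^+ 2 / 16)).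
    apply: cvgB; first exact: cvg_cst.
    apply: cvgMr; under eq_fun do rewrite -exprVn; apply: cvg_expr.
    by rewrite ger0_norm ?invr_ge0 // invf_lt1 // ltr1n.
  - exact: cvg_cst.
suff -> : (pi : R) ^+ 2 / 6 = limn u by [].
have : limn u - limn u / 4 = (pi : R) ^+ 2 / 8 by apply: cvg_unique oL oP.
move: (limn u) ((pi : R) ^+ 2) => L p; lra.
Qed.

(** * The mean value of the coefficients *)

Lemma sum_totient_divisors (R : pzSemiRingType) n : (0 < n)%N ->
  \sum_(d <- divisors n) (totient d)%:R = n%:R :> R.
Proof.
move=> n0; rewrite -natr_sum; congr _%:R.
rewrite -[RHS]sum_totient_dvd (big_divisors totient n0) big_mkcond big_add1 /=.
rewrite [RHS]big_mkcond big_ord_recl /= if_same add0n big_mkord.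
by apply: eq_bigr.
Qed.

(** The Dirichlet convolution of phi(d) / d^3 and 1 / m^3 at r is r^-3 times the sum of phi over the
    divisors of r, that is 1 / r^2. *)
Lemma psum_inv_sq_totient (R : realType) n :
  psum (fun d => (d%:R ^+ 2)^-1) n =
  \sum_(1 <= d < n.+1)
    (totient d)%:R / d%:R ^+ 3 * psum (fun m => (m%:R ^+ 3)^-1) (n %/ d) :> R.
Proof.
pose f d m : R := (totient d)%:R / d%:R ^+ 3 * (m%:R ^+ 3)^-1.
under [RHS]eq_bigr do rewrite /psum big_distrr /=.
rewrite -(sum_divisors_hyperbola f) /psum; apply: eq_big_nat => r /andP [r0 _].
have rn0 : (r%:R : R) != 0 by rewrite pnatr_eq0 -lt0n.
rewrite (eq_big_seq (fun d => (totient d)%:R / r%:R ^+ 3)); last first.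
  move=> d; rewrite -dvdn_divisors // => dr.
  have dn0 : (d%:R : R) != 0 by rewrite pnatr_eq0 -lt0n (dvdn_gt0 r0 dr).
  rewrite /f natf_div //; move: (d%:R : R) (r%:R : R) dn0 rn0 => a b a0 b0.
  by field; rewrite a0 b0.
rewrite -mulr_suml sum_totient_divisors //.
by move: (r%:R : R) rn0 => b b0; field.
Qed.

Lemma psum_inv_cube_zeta (R : realType) :
  psum (fun m => (m%:R ^+ 3)^-1) = series (fun n : nat => n.+1%:R `^ (- 3)) :> (nat -> R).
Proof.
apply/funext => n; rewrite /psum /series /= big_add1 /=.
by apply: eq_bigr => i _; rewrite powR_invn.
Qed.

Lemma inv_cube_le_inv_sq (R : realType) d : (d%:R ^+ 3)^-1 <= (d%:R ^+ 2)^-1 :> R.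
Proof.
case: d => [|d]; first by rewrite !expr0n.
rewrite lef_pV2 ?posrE ?exprn_gt0 ?ltr0n //.
by rewrite ler_weXn2l ?ler1n.
Qed.

Lemma cvg_psum_inv_cube (R : realType) :
  (psum (fun m => (m%:R ^+ 3)^-1) n @[n --> \oo] --> (zeta 3 : R))%classic.
Proof.
rewrite psum_inv_cube_zeta; change (cvgn (series (fun n : nat => n.+1%:R `^ (- 3) : R))).
rewrite -psum_inv_cube_zeta; apply: (@is_cvg_psum _ _ 2) => n.
  by rewrite invr_ge0 exprn_ge0.
apply: le_trans (psum_inv_sq_le2 R n).
by apply: ler_sum => d _; exact: inv_cube_le_inv_sq.
Qed.

Lemma zeta3_ge1 (R : realType) : 1 <= zeta 3 :> R.
Proof.
rewrite -(cvg_lim (@Rhausdorff R) (@cvg_psum_inv_cube R)).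
apply: limr_ge; first by apply/cvg_ex; exists (zeta 3); exact: cvg_psum_inv_cube.
exists 1%N => // n /= n1; rewrite /psum big_ltn // expr1n invr1 lerDl.
by apply: sumr_ge0 => d _; rewrite invr_ge0 exprn_ge0.
Qed.

Lemma cvg_psum_totient (R : realType) :
  (psum (fun d => (totient d)%:R / d%:R ^+ 3) n @[n --> \oo] -->
   ((pi : R) ^+ 2 / 6 / zeta 3))%classic.
Proof.
set S := psum _; pose z : nat -> R := psum (fun m => (m%:R ^+ 3)^-1).
pose u : nat -> R := psum (fun d => (d%:R ^+ 2)^-1).
have z0 d : 0 <= (d%:R ^+ 3)^-1 :> R by rewrite invr_ge0 exprn_ge0.
have a0 d : 0 <= (totient d)%:R / d%:R ^+ 3 :> R by rewrite divr_ge0 ?exprn_ge0.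
have zE := nondecreasing_psum z0.
have sqoo : ((n * n)%N @[n --> \oo] --> \oo)%classic.
  by move=> A [N _ NA]; exists N => // n /= Nn; apply: NA => /=; nia.
(* The product S(n) z(n) runs over the pairs d, m <= n. These include all pairs with dm <= n and
   satisfy dm <= n^2, so the product lies between u(n) and u(n^2), which both tend to zeta(2). *)
have Sz : (S n * z n @[n --> \oo] --> (pi : R) ^+ 2 / 6)%classic.
  apply: (squeeze_cvgr (f := u) (h := fun n => u (n * n)%N)); last 2 first.
  - exact: cvg_psum_inv_sq.
  - exact: (cvg_comp (fun n => n * n)%N u sqoo (@cvg_psum_inv_sq R)).
  apply: nearW => n; rewrite /u !psum_inv_sq_totient /S /psum big_distrl /=.
  apply/andP; split.
    apply: ler_sum => d _; apply: ler_wpM2l => //; apply: zE; exact: leq_div.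
  rewrite [leRHS](big_cat_nat (n := n.+1)) //=; last by rewrite ltnS; nia.
  rewrite -[leLHS]addr0; apply: lerD; last first.
    by apply: sumr_ge0 => d _; rewrite mulr_ge0 // sumr_ge0.
  rewrite [leLHS]big_nat [leRHS]big_nat; apply: ler_sum => d /andP [d0 dn].
  apply: ler_wpM2l => //; apply: zE; rewrite leq_divRL // leq_mul2l.
  by rewrite -ltnS dn orbT.
have z3 : zeta 3 != 0 :> R by rewrite gt_eqF // (lt_le_trans _ (zeta3_ge1 R)).
have H := cvgM Sz (cvgV z3 (@cvg_psum_inv_cube R)).
have E : (\forall n \near \oo, S n * z n * (z n)^-1 = S n)%classic.
  exists 1%N => // n /= n1; rewrite mulfK // gt_eqF // /z /psum big_ltn // expr1n invr1.
  by rewrite ltr_pwDl // sumr_ge0.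
by move/near_eq_cvg/cvg_trans: E; apply; exact: H.
Qed.

Lemma psum_even (R : realType) (f : nat -> R) n :
  psum (fun d => if odd d then 0 else f d) n = psum (fun e => f (2 * e)%N) (n %/ 2).
Proof.
elim: n => [|n IHn]; first by rewrite div0n /psum !big_geq.
rewrite psumS IHn divnS // dvdn2 /=; case: (boolP (odd n)) => on /=; last by rewrite addr0.
rewrite add1n psumS; congr (_ + f _).
by rewrite divn2 mul2n doubleS -[in LHS](odd_double_half n) on.
Qed.

Lemma totient_double e :
  totient (2 * e) = if odd e then totient e else (2 * totient e)%N.
Proof.
have [->|e0] := posnP e; first by [].
have [k [m om ->]] := pow2_odd_factor e0.
have c2 i : coprime (2 ^ i) m by rewrite coprimeXl // coprime2n.
case: k => [|k]; first by rewrite mul1n om totient_coprime ?coprime2n // mul1n.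
by rewrite oddM oddX /= mulnA -expnS !(totient_coprime (c2 _)) !totient_pfactor //= mulnA !mul1n expnS.
Qed.

(* phi(2d) is phi(d) or 2 phi(d) according to the parity of d, which expresses the
   parts d even and 4 | d of the sums through shorter sums. *)
Lemma sum_N4_coefE (R : realType) (a := fun d => (totient d)%:R / d%:R ^+ 3 : R)
    (e := psum (fun d => if odd d then 0 else a d)) n :
  (e n = (psum a (n %/ 2) + e (n %/ 2)%N) / 8) *
  (psum (fun d => N4_coef R d / d%:R) n = psum a n - e n - e (n %/ 2)%N).
Proof.
have a2 d : a (2 * d)%N = (a d + if odd d then 0 else a d) / 8.
  rewrite /a totient_double natrM; case: d => [|d]; first by rewrite !mul0r addr0 mul0r.
  have d0 : (d.+1%:R : R) != 0 by rewrite pnatr_eq0.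
  by case: ifP => _; rewrite ?natrM; move: (d.+1%:R : R) d0 => c c0; field.
split.
  rewrite {1}/e psum_even /e /psum -big_split mulr_suml /=.
  by apply: eq_bigr => d _.
have -> : e (n %/ 2)%N = 4 * psum (fun d => if odd d then 0 else if (4 %| d)%N then a d else 0) n.
  rewrite psum_even /e /psum big_distrr /=; apply: eq_bigr => d _.
  rewrite -[4%N]/(2 * 2)%N dvdn_pmul2l // dvdn2 a2.
  by case: (odd d) => /=; rewrite ?mulr0 //; field.
rewrite /e /psum big_distrr -!sumrB; apply: eq_bigr => d _ /=.
have aE : (totient d)%:R / d%:R ^+ 2 / d%:R = a d.
  by rewrite /a -mulrA -invfM -exprSr.
rewrite /N4_coef -(mulrA (if _ then _ else _)) -mulrA aE.
by case: (boolP (odd d)) => od; [rewrite mulr0 !subr0 mul1r | case: ifP => _; ring].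
Qed.

(** In the limit the two relations of [sum_N4_coefE] become e = (L + e) / 8, so e = L / 7, and the
    value L - 2e = 5L / 7 with L = zeta(2) / zeta(3). *)
Lemma cvg_psum_N4_coef (R : realType) :
  (psum (fun d => N4_coef R d / d%:R) n @[n --> \oo] -->
   5 * (pi : R) ^+ 2 / (42 * zeta 3))%classic.
Proof.
pose a d : R := (totient d)%:R / d%:R ^+ 3.
pose e : nat -> R := psum (fun d => if odd d then 0 else a d).
have a0 d : 0 <= a d by rewrite divr_ge0 ?exprn_ge0.
have Sc := @cvg_psum_totient R; set L := _ / zeta 3 in Sc.
have half := @cvg_divnr 2 isT.
have ec : cvgn e.
  apply: (@is_cvg_psum _ _ 2) => n; first by case: ifP.
  apply: le_trans (psum_inv_sq_le2 R n); apply: ler_sum => d _.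
  case: ifP => _; first by rewrite invr_ge0 exprn_ge0.
  case: d => [|d]; first by rewrite /a mul0r invr_ge0 exprn_ge0.
  have d0 : (0 : R) < d.+1%:R by rewrite ltr0n.
  rewrite /a ler_pdivrMr ?exprn_gt0 // [d.+1%:R ^+ 3]exprSr mulKf ?expf_neq0 ?gt_eqF //.
  by rewrite ler_nat totient_leq.
have S2 : (psum a (n %/ 2)%N @[n --> \oo] --> L)%classic.
  exact: (cvg_comp (fun n => n %/ 2)%N (psum a) half Sc).
have e2 : (e (n %/ 2)%N @[n --> \oo] --> limn e)%classic.
  exact: (cvg_comp (fun n => n %/ 2)%N e half ec).
have eE : limn e = (L + limn e) / 8.
  have h : ((psum a (n %/ 2)%N + e (n %/ 2)%N) / 8 @[n --> \oo] --> (L + limn e) / 8)%classic.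
    by apply: cvgMl; apply: cvgD S2 e2.
  apply: (cvg_unique (@Rhausdorff R) ec); apply: cvg_trans h.
  by apply: near_eq_cvg; apply: nearW => n; rewrite /e /a [RHS]sum_N4_coefE.
rewrite (_ : psum _ = (fun n => psum a n - e n - e (n %/ 2)%N)); last first.
  by apply/funext => n; rewrite /e /a sum_N4_coefE.
rewrite (_ : 5 * (pi : R) ^+ 2 / (42 * zeta 3) = L - limn e - limn e).
  by apply: cvgB => //; apply: cvgB.
have aux (x y : R) : x = (y + x) / 8 -> x = y / 7 by lra.
rewrite (aux _ _ eE).
have z3 : zeta 3 != 0 :> R by rewrite gt_eqF // (lt_le_trans _ (zeta3_ge1 R)).
by rewrite /L; move: (zeta 3 : R) (pi : R) z3 => z p z0; field.
Qed.

(** The terms are at most 4 / d^2 in absolute value, so the sum from n + 1 to m is at most 4 (1 / n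
    - 1 / m); then m tends to infinity. *)
Lemma N4_coef_tail (R : realType) n : (0 < n)%N ->
  `|5 * (pi : R) ^+ 2 / (42 * zeta 3) - psum (fun d => N4_coef R d / d%:R) n| <= 4 / n%:R.
Proof.
move=> n0; set u := psum _.
have H : (`|u k - u n| @[k --> \oo] --> `|5 * (pi : R) ^+ 2 / (42 * zeta 3) - u n|)%classic.
  by apply: cvg_norm; apply: cvgB; [exact: cvg_psum_N4_coef | exact: cvg_cst].
rewrite -(cvg_lim (@Rhausdorff R) H); apply: limr_le.
  by apply/cvg_ex; eexists; exact: H.
exists n => // m /= nm.
rewrite /u /psum [X in X - _](big_cat_nat (n := n.+1)) //= addrAC subrr add0r.
apply: le_trans (ler_norm_sum _ _ _) _.
apply: (@le_trans _ _ (\sum_(n.+1 <= d < m.+1) 4 * (d%:R ^+ 2)^-1)).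
  apply: ler_sum => d _; rewrite normrM normfV normr_nat.
  by rewrite expr2 invfM mulrA ler_wpM2r ?invr_ge0 // ler_norm_N4_coef.
rewrite -big_distrr /= ler_wpM2l //.
have := @sum_inv_sq_tail R n m; rewrite n0 nm => /(_ isT) h.
by apply: le_trans h _; rewrite gerBl invr_ge0.
Qed.

(** * The summatory function *)

Lemma psum_cubes (R : realType) n :
  psum (fun m => m%:R ^+ 3) n = (n%:R * (n%:R + 1)) ^+ 2 / 4 :> R.
Proof.
elim: n => [|n IHn]; first by rewrite /psum big_geq // mul0r expr0n mul0r.
by rewrite psumS IHn -(natr1 n); move: (n%:R : R) => c; field.
Qed.

(** As n lies between y - 1 and y, four times the sum lies between ((y - 1) y)^2 and (y (y + 1))^2,
    that is y^4 - 2y^3 + y^2 and y^4 + 2y^3 + y^2, and y^2 <= y^3. *)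
Lemma psum_cubes_approx (R : realType) n (y : R) : 1 <= y -> n%:R <= y < n%:R + 1 ->
  `|psum (fun m => m%:R ^+ 3) n - y ^+ 4 / 4| <= y ^+ 3.
Proof.
rewrite psum_cubes => y1 /andP [ny yn].
have : (0 : R) <= n%:R by []. 
move: (n%:R : R) ny yn => c cy yc c0.
have up : (c * (c + 1)) ^+ 2 <= (y * (y + 1)) ^+ 2.
  by rewrite ler_pXn2r ?nnegrE ?mulr_ge0 ?ler_pM //; lra.
have lo : ((y - 1) * y) ^+ 2 <= (c * (c + 1)) ^+ 2.
  by rewrite ler_pXn2r ?nnegrE ?mulr_ge0 ?ler_pM //; lra.
have y2 : y ^+ 2 <= y ^+ 3 by rewrite [y ^+ 3]exprS ler_peMl ?exprn_ge0 //; lra.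
have y20 : 0 <= y ^+ 2 by rewrite exprn_ge0 //; lra.
have e1 : (y * (y + 1)) ^+ 2 = y ^+ 4 + 2 * y ^+ 3 + y ^+ 2 by ring.
have e2 : ((y - 1) * y) ^+ 2 = y ^+ 4 - 2 * y ^+ 3 + y ^+ 2 by ring.
move: up lo y2 y20; rewrite e1 e2.
move: (y ^+ 4) (y ^+ 3) (y ^+ 2) ((c * (c + 1)) ^+ 2) => a b d f *.
by rewrite ler_norml; apply/andP; split; lra.
Qed.

Lemma psum_harmonic (R : realType) n : (0 < n)%N ->
  psum (fun d => d%:R^-1) n <= 1 + ln (n%:R : R).
Proof.
case: n => // n _; elim: n => [|n IHn]; first by rewrite psumS /psum big_geq // add0r invr1 ln1 addr0.
rewrite psumS.
have n1 : (0 : R) < n.+1%:R by rewrite ltr0n.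
have n2 : (0 : R) < n.+2%:R by rewrite ltr0n.
have e : 1 + - n.+2%:R^-1 = n.+1%:R / n.+2%:R :> R.
  by rewrite -(natr1 n.+1); move: (n.+1%:R : R) n1 => c c0; field; rewrite gt_eqF // addr_gt0.
(* The bound ln(1 + u) <= u at u = -1 / (n + 2) gives 1 / (n + 2) <= ln(n + 2) - ln(n + 1). *)
have lt1 : - 1 < - n.+2%:R^-1 :> R by rewrite ltrN2 invf_lt1 // ltr1n.
have := le_ln1Dx lt1; rewrite e ln_div ?posrE // => h.
move: IHn h; move: (psum _ _) (ln _) (ln _) (n.+2%:R^-1) => *; lra.
Qed.

Lemma sum_N4_hyperbola (R : realType) n :
  \sum_(1 <= r < n.+1) (N4 0 r)%:R =
  \sum_(1 <= d < n.+1) N4_coef R d * d%:R ^+ 3 * psum (fun m => m%:R ^+ 3) (n %/ d).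
Proof.
pose f d m : R := N4_coef R d * d%:R ^+ 3 * m%:R ^+ 3.
under [RHS]eq_bigr do rewrite /psum big_distrr /=.
rewrite -(sum_divisors_hyperbola f); apply: eq_big_nat => r /andP [r0 _].
rewrite natr_N4 // big_distrr /=; apply: eq_big_seq => d; rewrite -dvdn_divisors // => dr.
by rewrite /f -mulrA -exprMn -natrM mulnC divnK // mulrC.
Qed.

Lemma sum_N4_approx (R : realType) (x : R) : 2 <= x ->
  `|\sum_(1 <= r < (Num.truncn x).+1) (N4 0 r)%:R
     - 5 * (pi : R) ^+ 2 / (168 * zeta 3) * x ^+ 4| <= x ^+ 3 * (6 + 4 * ln x).
Proof.
move=> x2; set n := Num.truncn x.
have x0 : 0 < x by lra.
have /andP [nx xn] : n%:R <= x < n.+1%:R by apply: truncn_itv; lra.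
have n0 : (0 < n)%N by rewrite truncn_gt0; lra.
have nR0 : (0 : R) < n%:R by rewrite ltr0n.
set G := 5 * (pi : R) ^+ 2 / (42 * zeta 3).
have -> : 5 * (pi : R) ^+ 2 / (168 * zeta 3) = G / 4.
  have z3 : zeta 3 != 0 :> R by rewrite gt_eqF // (lt_le_trans _ (zeta3_ge1 R)).
  by rewrite /G; move: (zeta 3 : R) (pi : R) z3 => z p z0; field.
set g := psum (fun d => N4_coef R d / d%:R) n.
set A := \sum_(1 <= r < _) _.
have -> : A - G / 4 * x ^+ 4 = (A - x ^+ 4 / 4 * g) - x ^+ 4 / 4 * (G - g) by ring.
apply: le_trans (ler_normB _ _) _.
(* The coefficient tail 4 / n gives x^4 / n, and x < n + 1 <= 2n. *)
have tail : `|x ^+ 4 / 4 * (G - g)| <= 2 * x ^+ 3.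
  rewrite normrM ger0_norm ?divr_ge0 ?exprn_ge0 ?(ltW x0) //.
  apply: le_trans (ler_wpM2l _ (N4_coef_tail R n0)) _; first by rewrite divr_ge0 ?exprn_ge0 ?(ltW x0).
  rewrite mulrA divfK ?pnatr_eq0 // ler_pdivrMr // [x ^+ 4]exprS [leRHS]mulrAC.
  rewrite ler_wpM2r ?exprn_ge0 ?(ltW x0) //.
  have : 1 <= n%:R :> R by rewrite ler1n.
  by move: xn; rewrite -(natr1 n); lra.
(* Each d costs at most |g(d)| d^3 (x / d)^3 <= 4 x^3 / d, and the harmonic sum is at most 1 + ln
   x. *)
have main : `|A - x ^+ 4 / 4 * g| <= 4 * x ^+ 3 * (1 + ln x).
  rewrite /A sum_N4_hyperbola /g /psum big_distrr /= -sumrB.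
  apply: le_trans (ler_norm_sum _ _ _) _.
  apply: (@le_trans _ _ (\sum_(1 <= d < n.+1) 4 * x ^+ 3 * d%:R^-1)); last first.
    rewrite -big_distrr /= ler_wpM2l ?mulr_ge0 ?exprn_ge0 ?(ltW x0) //.
    by apply: le_trans (psum_harmonic R n0) _; rewrite lerD2l ler_ln ?posrE.
  rewrite big_nat [leRHS]big_nat; apply: ler_sum => d /andP [d0 dn].
  have dR : (0 : R) < d%:R by rewrite ltr0n.
  rewrite -/(psum (fun m => m%:R ^+ 3) (n %/ d)).
  have -> : N4_coef R d * d%:R ^+ 3 * psum (fun m => m%:R ^+ 3) (n %/ d)
      - x ^+ 4 / 4 * (N4_coef R d / d%:R) =
    N4_coef R d * d%:R ^+ 3 * (psum (fun m => m%:R ^+ 3) (n %/ d) - (x / d%:R) ^+ 4 / 4).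
    move: (N4_coef R d) (psum _ _) => a b; move: (d%:R : R) dR => c c0.
    by field; rewrite gt_eqF.
  rewrite normrM normrM normrX normr_nat.
  have y1 : 1 <= x / d%:R.
    by rewrite ler_pdivlMr // mul1r (le_trans _ nx) // ler_nat -ltnS.
  have yb : (n %/ d)%:R <= x / d%:R < (n %/ d)%:R + 1.
    rewrite ler_pdivlMr // ltr_pdivrMr // natr1 -!natrM; apply/andP; split.
      by rewrite (le_trans _ nx) // ler_nat leq_divM.
    by rewrite (lt_le_trans xn) // ler_nat ltn_ceil.
  have h := psum_cubes_approx y1 yb.
  apply: (@le_trans _ _ (4 / d%:R * d%:R ^+ 3 * (x / d%:R) ^+ 3)).
    apply: ler_pM => //; by rewrite ler_wpM2r ?exprn_ge0 // ler_norm_N4_coef.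
  rewrite le_eqVlt; apply/orP; left; apply/eqP.
  by move: (d%:R : R) dR => c c0; field; rewrite gt_eqF.
apply: le_trans (lerD main tail) _; rewrite le_eqVlt; apply/orP; left; apply/eqP; ring.
Qed.

Unset Implicit Arguments.

Theorem proposition42 (R : realType) :
  (fun x : R => \sum_(1 <= r < (Num.truncn x).+1) (N4 0 r)%:R : R)
  = (fun x : R => 5 * pi ^+ 2 / (168 * zeta 3) * x ^+ 4)
  +O_ (pinfty_nbhs R) (fun x : R => x ^+ 3 * ln x).
Proof.
(* For x > e one has ln x >= 1, so 6 + 4 ln x <= 10 ln x: hence the constant 10 and the threshold
   [expR 1]. *)
apply/eqaddOP; exists 10; split; first exact: num_real.
move=> C C10; exists (expR 1); split; first exact: num_real.
move=> x ex; have x2 : 2 <= x.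
  by apply: le_trans (ltW ex); have := expR_ge1Dx (1 : R); lra.
have x0 : 0 < x by lra.
have l1 : 1 <= ln x by rewrite -(expRK 1) ler_ln ?posrE ?expR_gt0 // ltW.
have x3 : 0 <= x ^+ 3 by rewrite exprn_ge0 // ltW.
rewrite /= [`|x ^+ 3 * _|]ger0_norm; last by rewrite mulr_ge0 //; lra.
apply: le_trans (sum_N4_approx x2) _; rewrite mulrCA ler_wpM2l //.
have : 10 * ln x <= C * ln x by rewrite ler_wpM2r; lra.
lra.
Qed.
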